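(* Let $M_8$ be the $8$-dimensional simple ternary Malcev algebra over $\mathbb{C}$ constructed from the $8$-dimensional composition algebra $A$ (as described in the context). Then $M_8$ admits local derivations that are not derivations; moreover, the quotient of the space of local derivations of $M_8$ by the space of derivations of $M_8$ has dimension $7$.
   Context: The base field is $\mathbb{C}$. Let $A$ be an $8$-dimensional composition algebra with unity $1$ and involution $a\mapsto\bar a$, such that the symmetric bilinear form $\langle x,y\rangle=\frac12(x\bar y+y\bar x)$ (which takes values in $\mathbb{C}\cdot 1\cong\mathbb{C}$) is nonsingular; the associated quadratic form $x\mapsto\langle x,x\rangle$ is multiplicative. $M_8$ is the vector space $A$ with the ternary multiplication $$[x,y,z]=(x\bar y)z-\langle y,z\rangle x+\langle x,z\rangle y-\langle x,y\rangle z.$$ A derivation of $M_8$ is a linear map $D:M_8\to M_8$ with $D([x,y,z])=[D(x),y,z]+[x,D(y),z]+[x,y,D(z)]$ for all $x,y,z$. A local derivation of $M_8$ is a linear map $\nabla:M_8\to M_8$ such that for every $x\in M_8$ there exists a derivation $D_x$ of $M_8$ with $\nabla(x)=D_x(x)$. Every derivation is a local derivation. *)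

(* Defs.v *)
From HB Require Import structures.
From mathcomp Require Import all_boot all_order all_algebra.
From mathcomp Require Import sesquilinear generic_quotient ring_quotient.
From mathcomp Require Import boolp.

Set Implicit Arguments.
Unset Strict Implicit.
Unset Printing Implicit Defensive.

Import GRing.Theory VectorInternalTheory.
Local Open Scope ring_scope.
Local Open Scope quotient_scope.

Section QuotientSpace.
Variables (K : fieldType) (V : vectType K) (U : {vspace V}).

Definition vquot : Type := (Quotient.quot (pred_of_vspace U)).

HB.instance Definition _ := GRing.Zmodule.on vquot.

Definition vquot_pi (v : V) : vquot := \pi_((Quotient.quot (pred_of_vspace U))) v.

Definition vquot_repr (q : vquot) : V := repr (q : (Quotient.quot (pred_of_vspace U))).

Lemma vquot_reprK : cancel vquot_repr vquot_pi.
Proof. exact: reprK. Qed.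

Lemma vquot_eqP (x y : V) : (vquot_pi x = vquot_pi y) <-> (x - y \in U).
Proof.
rewrite (_ : (x - y \in U) = (x == y %[mod (Quotient.quot (pred_of_vspace U))])).
  by split=> [/eqP|/eqP].
exact: (Quotient.idealrBE (pred_of_vspace U)).
Qed.

Lemma vquot_piD (x y : V) : vquot_pi (x + y) = vquot_pi x + vquot_pi y.
Proof. by rewrite /vquot_pi raddfD. Qed.

Definition vquot_scale (a : K) (q : vquot) : vquot :=
  vquot_pi (a *: vquot_repr q).

Lemma vquot_scale_pi a v : vquot_scale a (vquot_pi v) = vquot_pi (a *: v).
Proof.
apply/vquot_eqP; rewrite -scalerBr memvZ //.
by apply/vquot_eqP; rewrite vquot_reprK.
Qed.

Fact vquot_scaleA a b q :
  vquot_scale a (vquot_scale b q) = vquot_scale (a * b) q.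
Proof. by rewrite -[q]vquot_reprK !vquot_scale_pi scalerA. Qed.

Fact vquot_scale1 : left_id 1 vquot_scale.
Proof. by move=> q; rewrite -[q]vquot_reprK vquot_scale_pi scale1r. Qed.

Fact vquot_scaleDr : right_distributive vquot_scale +%R.
Proof.
move=> a p q; rewrite -[p]vquot_reprK -[q]vquot_reprK -vquot_piD.
by rewrite !vquot_scale_pi scalerDr vquot_piD.
Qed.

Fact vquot_scaleDl q : {morph vquot_scale^~ q : a b / a + b}.
Proof.
move=> a b; rewrite -[q]vquot_reprK !vquot_scale_pi.
by rewrite scalerDl vquot_piD.
Qed.

HB.instance Definition _ := GRing.Zmodule_isLmodule.Build K vquot
  vquot_scaleA vquot_scale1 vquot_scaleDr vquot_scaleDl.

Fact vquot_pi_is_linear : linear vquot_pi.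
Proof.
by move=> a x y; rewrite vquot_piD -vquot_scale_pi.
Qed.

HB.instance Definition _ := GRing.isLinear.Build K V vquot *:%R vquot_pi
  vquot_pi_is_linear.

(* Finite-dimensionality: the classes are identified with a complement. *)
Let W : {vspace V} := (U^C)%VS.

Definition vquot_coord (q : vquot) : 'rV[K]_(dim (subvs_of W)) :=
  v2r (vsproj W (daddv_pi W U (vquot_repr q))).

Let capWU : (W :&: U = 0)%VS.
Proof. by rewrite capvC capv_compl. Qed.

Let vquot_pi0 u : u \in U -> daddv_pi W U u = 0.
Proof.
move=> uU; have := daddv_pi_add capWU (memv_add (mem0v W) uU).
rewrite add0r (daddv_pi_id _ uU) ?capv_compl // => /(congr1 (fun v => v - u)).
by rewrite addrK subrr.
Qed.

Let vquot_repr_pi v : daddv_pi W U (vquot_repr (vquot_pi v)) = daddv_pi W U v.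
Proof.
have /vquot_pi0 : vquot_repr (vquot_pi v) - v \in U.
  by apply/vquot_eqP; rewrite vquot_reprK.
by rewrite linearB => /eqP; rewrite subr_eq0 => /eqP.
Qed.

Fact vquot_coord_is_linear : linear vquot_coord.
Proof.
move=> a p q; rewrite -[p]vquot_reprK -[q]vquot_reprK -linearP.
by rewrite /vquot_coord !vquot_repr_pi !linearP.
Qed.

Fact vquot_coord_bij : bijective vquot_coord.
Proof.
exists (fun r => vquot_pi (vsval (r2v r))) => [q|r]; last first.
  rewrite /vquot_coord vquot_repr_pi daddv_pi_id ?capWU ?subvsP //.
  by rewrite vsvalK r2vK.
rewrite /vquot_coord v2rK vsprojK ?memv_pi //.
rewrite -[RHS]vquot_reprK; apply/vquot_eqP.
have wv : vquot_repr q \in (W + U)%VS by rewrite addvC addv_complf memvf.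
rewrite -{2}(daddv_pi_add capWU wv) opprD addrA subrr add0r rpredN.
exact: memv_pi.
Qed.

Fact vquot_vect_iso : Vector.axiom (dim (subvs_of W)) vquot.
Proof.
by exists vquot_coord; [exact: vquot_coord_is_linear | exact: vquot_coord_bij].
Qed.

HB.instance Definition _ := Lmodule_hasFinDim.Build K vquot vquot_vect_iso.

Lemma dim_vquot : \dim {:vquot} = (\dim {:V} - \dim U)%N.
Proof. by rewrite -dimv_compl !dimvf. Qed.

End QuotientSpace.

(* W / U, for subspaces U <= W of V: the preimage of U under the injection
   [vsval] is U viewed as a subspace of W. *)
Definition subvquot (K : fieldType) (V : vectType K) (W U : {vspace V}) :
    vectType K :=
  vquot (linfun (vsval : subvs_of W -> V) @^-1: U)%VS.

Lemma dim_subvquot (K : fieldType) (V : vectType K) (W U : {vspace V}) :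
  (U <= W)%VS -> \dim {:subvquot W U} = (\dim W - \dim U)%N.
Proof.
move=> sUW; rewrite dim_vquot dimvf; congr (_ - _)%N.
set f := linfun _; set P := (f @^-1: U)%VS.
have f_inj : lker f == 0%VS.
  by apply/lker0P => x y; rewrite !lfunE; apply: val_inj.
have -> : U = (f @: P)%VS.
  apply/eqP; rewrite eqEsubv; apply/andP; split; apply/subvP => u.
    move=> uU; have uW := subvP sUW _ uU.
    have fu : f (vsproj W u) = u by rewrite lfunE /= vsprojK.
    by rewrite -fu memv_img // -memv_preim fu.
  by case/memv_imgP => v vP ->; rewrite memv_preim.
by rewrite limg_dim_eq // (eqP f_inj) capv0.
Qed.

Section CompositionAlgebra.
Variables (K : numFieldType) (A : vectType K).

(* The product is not assumed associative. The value [cform x y] is the scalar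
   identified with the element (x ybar + y xbar) / 2 of K 1. *)
Record compositionAlgebra := CompositionAlgebra {
  cmul : {bilinear A -> A -> A};
  cone : A;
  cconj : {linear A -> A};
  cform : A -> A -> K;
  cmul1l : left_id cone cmul;
  cmul1r : right_id cone cmul;
  cconjK : involutive cconj;
  cconjM : forall x y, cconj (cmul x y) = cmul (cconj y) (cconj x);
  cformE : forall x y,
    cform x y *: cone = 2^-1 *: (cmul x (cconj y) + cmul y (cconj x));
  cform_nonsingular : forall x, (forall y, cform x y = 0) -> x = 0;
  cform_multiplicative : forall x y,
    cform (cmul x y) (cmul x y) = cform x x * cform y y
}.

End CompositionAlgebra.

Section TernaryAlgebra.
Variables (K : fieldType) (A : vectType K).

Record ternaryAlgebra := TernaryAlgebra {
  tbr :> A -> A -> A -> A;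
  tbr_linear1 : forall y z, linear (fun x => tbr x y z);
  tbr_linear2 : forall x z, linear (fun y => tbr x y z);
  tbr_linear3 : forall x y, linear (fun z => tbr x y z)
}.

Variable M : ternaryAlgebra.

Definition is_derivation (D : 'End(A)) : Prop :=
  forall x y z, D (M x y z) = M (D x) y z + M x (D y) z + M x y (D z).

Definition is_local_derivation (nabla : 'End(A)) : Prop :=
  forall x, exists2 D : 'End(A), is_derivation D & nabla x = D x.

Lemma is_derivation_closed a D E :
  is_derivation D -> is_derivation E -> is_derivation (a *: D + E).
Proof.
move=> hD hE x y z; rewrite !lfunE /= !lfunE /= hD hE.
rewrite (tbr_linear1 M y z) (tbr_linear2 M x z) (tbr_linear3 M x y).
by rewrite !scalerDr addrACA [X in X + _]addrACA.
Qed.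

Lemma is_derivation0 : is_derivation 0.
Proof.
move=> x y z.
have M1 y' z' : M 0 y' z' = 0.
  by have := tbr_linear1 M y' z' (-1) 0 0; rewrite scaler0 addr0 scaleN1r addNr.
have M2 x' z' : M x' 0 z' = 0.
  by have := tbr_linear2 M x' z' (-1) 0 0; rewrite scaler0 addr0 scaleN1r addNr.
have M3 x' y' : M x' y' 0 = 0.
  by have := tbr_linear3 M x' y' (-1) 0 0; rewrite scaler0 addr0 scaleN1r addNr.
by rewrite !lfunE /= M1 M2 M3 !addr0.
Qed.

Lemma is_local_derivation_closed a f g :
  is_local_derivation f -> is_local_derivation g ->
  is_local_derivation (a *: f + g).
Proof.
move=> hf hg x; have [D hD fx] := hf x; have [E hE gx] := hg x.
exists (a *: D + E); first exact: is_derivation_closed.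
by rewrite !lfunE /= !lfunE /= fx gx.
Qed.

Lemma derivation_is_local D : is_derivation D -> is_local_derivation D.
Proof. by move=> hD x; exists D. Qed.

End TernaryAlgebra.

Lemma vspace_of_closed (K : fieldType) (V : vectType K) (P : V -> Prop) :
  P 0 -> (forall a u v, P u -> P v -> P (a *: u + v)) ->
  exists U : {vspace V}, forall v, v \in U <-> P v.
Proof.
move=> P0 PD.
pose sub (U : {vspace V}) := forall v, v \in U -> P v.
pose Q n := `[< exists2 U, sub U & \dim U = n >].
have exQ : exists n, Q n.
  by exists 0%N; apply/asboolP; exists 0%VS; rewrite ?dimv0 // => v /vlineP[a ->];
     rewrite scaler0.
have ubQ n : Q n -> (n <= \dim {:V})%N.
  by move=> /asboolP[U _ <-]; rewrite dimvS // subvf.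
case: (ex_maxnP exQ ubQ) => n /asboolP[U subU dimU] maxn.
exists U => v; split=> [|Pv]; first exact: subU.
have subUv : sub (<[v]> + U)%VS.
  by move=> w /memv_addP[_ /vlineP[a ->] [u uU ->]]; apply: PD => //; apply: subU.
have : (\dim (<[v]> + U) <= \dim U)%N.
  by rewrite dimU; apply: maxn; apply/asboolP; exists (<[v]> + U)%VS.
rewrite (geq_leqif (dimv_leqif_sup (addvSr _ _))) => sUv.
by rewrite memvE (subv_trans (addvSl _ U)).
Qed.

Section DerivationSpaces.
Variables (K : fieldType) (A : vectType K) (M : ternaryAlgebra A).

Fact derivation_vspace :
  exists U : {vspace 'End(A)}, forall D, D \in U <-> is_derivation M D.
Proof.
by apply: vspace_of_closed; [exact: is_derivation0|exact: is_derivation_closed].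
Qed.

Fact local_derivation_vspace :
  exists U : {vspace 'End(A)}, forall D, D \in U <-> is_local_derivation M D.
Proof.
apply: vspace_of_closed; last exact: is_local_derivation_closed.
exact/derivation_is_local/is_derivation0.
Qed.

(* Membership in these subspaces is characterised by [DerP] and [LocDerP]. *)
Definition Der : {vspace 'End(A)} := sval (cid derivation_vspace).
Definition LocDer : {vspace 'End(A)} := sval (cid local_derivation_vspace).

Lemma DerP D : D \in Der <-> is_derivation M D.
Proof. exact: (svalP (cid derivation_vspace)). Qed.

Lemma LocDerP D : D \in LocDer <-> is_local_derivation M D.
Proof. exact: (svalP (cid local_derivation_vspace)). Qed.

Lemma Der_sub_LocDer : (Der <= LocDer)%VS.
Proof. by apply/subvP => D /DerP /derivation_is_local /LocDerP. Qed.

End DerivationSpaces.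

Section LinearCombinations.
Variables (K : fieldType) (A : vectType K).

Lemma linear_add (f g : A -> A) :
  linear f -> linear g -> linear (fun x => f x + g x).
Proof. by move=> hf hg a x y; rewrite hf hg scalerDr addrACA. Qed.

Lemma linear_opp (f : A -> A) : linear f -> linear (fun x => - f x).
Proof. by move=> hf a x y; rewrite hf opprD scalerN. Qed.

Lemma linear_scale b (f : A -> A) : linear f -> linear (fun x => b *: f x).
Proof. by move=> hf a x y; rewrite hf scalerDr !scalerA mulrC. Qed.

End LinearCombinations.

Section TernaryMalcev.
Variables (K : numFieldType) (A : vectType K) (O : compositionAlgebra A).

Local Notation mul := (cmul O).
Local Notation bar := (cconj O).
Local Notation form := (cform O).

Definition malcev_bracket (x y z : A) : A :=
  mul (mul x (bar y)) z - form y z *: x + form x z *: y - form x y *: z.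

Let formZ x y z :
  form x y *: z = 2^-1 *: (mul (mul x (bar y)) z + mul (mul y (bar x)) z).
Proof.
by rewrite -[in LHS](cmul1l O z) -linearZl_LR cformE linearZl_LR linearDl.
Qed.

Let mul_linl y : linear (fun x => mul x y).
Proof. by move=> a x x'; rewrite linearDl linearZl_LR. Qed.

Let mul_linr x : linear (fun y => mul x y).
Proof. by move=> a y y'; rewrite linearDr linearZr_LR. Qed.

Let bar_lin : linear bar.
Proof. by move=> a x y; rewrite linearP. Qed.

Let form_linear1 (y z : A) : linear (fun x => form x y *: z).
Proof.
move=> a x x'; rewrite !formZ !(mul_linl, bar_lin, mul_linr).
rewrite addrACA -scalerDr [LHS]scalerDr; congr (_ + _).
by rewrite !scalerA mulrC.
Qed.

Let form_linear2 (x z : A) : linear (fun y => form x y *: z).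
Proof.
move=> a y y'; rewrite !formZ !(mul_linl, bar_lin, mul_linr).
rewrite addrACA -scalerDr [LHS]scalerDr; congr (_ + _).
by rewrite !scalerA mulrC.
Qed.

Fact malcev_linear1 y z : linear (fun x => malcev_bracket x y z).
Proof.
rewrite /malcev_bracket; do ![apply: linear_add | apply: linear_opp].
- by move=> a x x'; rewrite !linearPl.
- by apply: linear_scale.
- exact: form_linear1.
- exact: form_linear1.
Qed.

Fact malcev_linear2 x z : linear (fun y => malcev_bracket x y z).
Proof.
rewrite /malcev_bracket; do ![apply: linear_add | apply: linear_opp].
- by move=> a y y'; rewrite !(linearP, linearPl).
- exact: form_linear1.
- by apply: linear_scale.
- exact: form_linear2.
Qed.

Fact malcev_linear3 x y : linear (fun z => malcev_bracket x y z).
Proof.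
rewrite /malcev_bracket; do ![apply: linear_add | apply: linear_opp].
- by move=> a z z'; rewrite mul_linr.
- exact: form_linear2.
- exact: form_linear2.
- by apply: linear_scale.
Qed.

Definition ternaryMalcev : ternaryAlgebra A :=
  TernaryAlgebra malcev_linear1 malcev_linear2 malcev_linear3.

End TernaryMalcev.

(* Main.v *)
Require Import Defs.
From HB Require Import structures.
From mathcomp Require Import all_boot all_order all_algebra.
From mathcomp Require Import sesquilinear ring complex reals.

Set Implicit Arguments.
Unset Strict Implicit.
Unset Printing Implicit Defensive.

Local Open Scope ring_scope.
Local Open Scope complex_scope.

Import GRing.Theory.

(** The local derivations of M8 are exactly the operators that are skew for the
form, an so(8), while the derivations form the image of so(7) under the spin
representation; the left multiplications L_u by imaginary u are a complement.

- Derivations are skew ([derivation_skew]): the square of z |-> [x, y, z] is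
  minus the Gram determinant of x, y, modulo the span of x and y, so a
  derivation preserves this determinant infinitesimally, which forces it to be
  skew. A local derivation nabla then satisfies f (nabla x) x = 0, so it is skew.
- There are many derivations: a skew D such that every [D, L_w] is again a left
  multiplication is a derivation ([skew_crit], a form of local triality). This
  covers [L_u, L_v] and L_u + 2 R_u for imaginary u, v. Their combinations
  contain, for all a and b, the operator [spin_der a b], which is four times
  the rotation z |-> f a z b - f b z a plus a left multiplication by an
  imaginary element.
- These derivations move a nonzero x in all directions orthogonal to x, also
  when x is isotropic ([der_orbit]); hence every skew operator is a local
  derivation.
- Rotations span the skew operators, so each skew operator is a derivation plus
  some L_u ([skew_split]); and L_u is a derivation only if u associates with
  everything, which in dimension 8 means u = 0 ([derivation_mul_eq0]).

So LocDer is the direct sum of Der and of the L_u, and the imaginary elements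
form a space of dimension 7. The argument uses no coordinates on the octonions. *)

Section Octonions.

Variables (K : numFieldType) (A : vectType K) (O : compositionAlgebra A).
Hypothesis dimA : \dim {:A} = 8%N.

Local Notation "x ** y" := (cmul O x y) (at level 40, left associativity).
Local Notation f := (cform O).
Local Notation q x := (f x x).
Local Notation e := (cone O).
Local Notation bar := (cconj O).
Local Notation M8 := (ternaryMalcev O).
Local Notation imag u := (f u e = 0).

(** * Composition algebras *)

Lemma two_neq0 : (2 : K) != 0.
Proof. by rewrite Num.Theory.pnatr_eq0. Qed.

Lemma cone_neq0 : e != 0.
Proof.
apply/eqP => e0; have : (\dim {:A} <= 0)%N.
  suff -> : fullv = 0%VS :> {vspace A} by rewrite dimv0.
  apply/eqP; rewrite -subv0; apply/subvP => x _; rewrite memv0.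
  by rewrite -(cmul1l O x) e0 linear0l.
by rewrite dimA.
Qed.

Lemma cone_inj a b : a *: e = b *: e -> a = b.
Proof.
move/eqP; rewrite -subr_eq0 -scalerBl scaler_eq0 (negbTE cone_neq0) orbF.
by rewrite subr_eq0 => /eqP.
Qed.

Lemma mulDl x y z : (x + y) ** z = x ** z + y ** z.
Proof. exact: linearDl. Qed.
Lemma mulDr x y z : x ** (y + z) = x ** y + x ** z.
Proof. exact: linearDr. Qed.
Lemma mulZl a x y : (a *: x) ** y = a *: (x ** y).
Proof. exact: linearZl_LR. Qed.
Lemma mulZr a x y : x ** (a *: y) = a *: (x ** y).
Proof. exact: linearZr_LR. Qed.
Lemma mulNl x y : (- x) ** y = - (x ** y).
Proof. by rewrite -scaleN1r mulZl scaleN1r. Qed.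
Lemma mulNr x y : x ** (- y) = - (x ** y).
Proof. by rewrite -scaleN1r mulZr scaleN1r. Qed.
Definition mulE := (mulDl, mulDr, mulNl, mulNr, mulZl, mulZr, cmul1l, cmul1r).

Lemma formC x y : f x y = f y x.
Proof. by apply: cone_inj; rewrite !cformE addrC. Qed.
Lemma formDl x y z : f (x + y) z = f x z + f y z.
Proof.
apply: cone_inj; rewrite scalerDl !cformE -scalerDr; congr (_ *: _).
by rewrite linearD !mulE addrACA.
Qed.
Lemma formZl a x y : f (a *: x) y = a * f x y.
Proof.
apply: cone_inj; rewrite cformE -scalerA cformE linearZ_LR !mulE -scalerDr.
by rewrite !scalerA mulrC.
Qed.
Lemma formNl x y : f (- x) y = - f x y.
Proof. by rewrite -scaleN1r formZl mulN1r. Qed.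
Lemma formDr x y z : f z (x + y) = f z x + f z y.
Proof. by rewrite formC formDl !(formC z). Qed.
Lemma formZr a x y : f y (a *: x) = a * f y x.
Proof. by rewrite formC formZl (formC y). Qed.
Lemma formNr x y : f y (- x) = - f y x.
Proof. by rewrite formC formNl (formC y). Qed.
Definition formE := (formDl, formDr, formZl, formZr, formNl, formNr).

Lemma form0l x : f 0 x = 0.
Proof. by rewrite -(scale0r 0) formZl mul0r. Qed.

Lemma form_inj x y : (forall w, f x w = f y w) -> x = y.
Proof.
move=> xy; apply/eqP; rewrite -subr_eq0; apply/eqP.
by apply: (cform_nonsingular (c := O)) => w; rewrite !formE xy subrr.
Qed.

(** An identity between vectors whose products are in normal form becomes, once
paired with an arbitrary vector, a polynomial identity between scalars. *)
Local Ltac vring := apply: form_inj; intro; rewrite !formE ?form0l; ring.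

(** Multiplicativity gives q e * q x = q x, and q cannot vanish identically. *)
Lemma form_ee : f e e = 1.
Proof.
have h x : f e e * q x = q x by rewrite -(cform_multiplicative O) cmul1l.
have [x x0] : exists x, q x != 0.
  apply/boolp.not_existsP => H.
  suff : e = 0 by apply/eqP; exact: cone_neq0.
  apply: form_inj => w; rewrite form0l.
  have qx x : q x = 0 by apply/eqP; apply: contra_notT (H x).
  have := qx (e + w); rewrite !formE !qx (formC w) add0r addr0.
  by move/eqP; rewrite -mulr2n -mulr_natl mulf_eq0 (negbTE two_neq0) => /eqP.
by apply: (mulIf x0); rewrite h mul1r.
Qed.

Lemma bar1 : bar e = e.
Proof. by rewrite -[LHS](cmul1l O) -{1}(cconjK O e) -cconjM cmul1l cconjK. Qed.

Lemma barE x : bar x = (2 * f x e) *: e - x.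
Proof.
rewrite -scalerA cformE scalerA divff ?two_neq0 // scale1r bar1.
by rewrite cmul1r cmul1l addrAC subrr add0r.
Qed.

Lemma barD x y : bar (x + y) = bar x + bar y.
Proof. exact: linearD. Qed.

Lemma form_bar x y : f (bar x) y = f x (bar y).
Proof. rewrite !barE !formE (formC e y); ring. Qed.

(** Polarisation in both arguments of the multiplicativity of the norm. *)
Lemma form_mulM x y z w :
  f (x ** y) (z ** w) + f (z ** y) (x ** w) = 2 * f x z * f y w.
Proof.
have h a b c : f (a ** b) (a ** c) = q a * f b c.
  have := cform_multiplicative O a (b + c).
  rewrite !mulE !formE !(cform_multiplicative O) (formC c) (formC (a ** c)).
  move=> H; apply: (mulfI two_neq0).
  have -> : 2 * f (a ** b) (a ** c) = q a * (q b + f b c + (f b c + q c))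
     - q a * q b - q a * q c by rewrite -H; ring.
  by ring.
have := h (x + z) y w; rewrite !mulE !formE !h (formC z x) => H.
have -> : f (x ** y) (z ** w) + f (z ** y) (x ** w) =
  (q x + f x z + (f x z + q z)) * f y w - q x * f y w - q z * f y w.
  by rewrite -H; ring.
by ring.
Qed.

(** The adjoint of a left multiplication by x is the one by the conjugate of x;
this is [form_mulM] with third argument 1, since bar x = 2 f x e - x. *)
Lemma form_mull x y z : f (x ** y) z = f y (bar x ** z).
Proof.
have := form_mulM x y e z; rewrite !cmul1l => H.
rewrite barE !mulE !formE.
rewrite -[LHS](addrK (f y (x ** z))) H; ring.
Qed.

Lemma form_barbar x y : f (bar x) (bar y) = f x y.
Proof. by rewrite form_bar cconjK. Qed.

Lemma form_mulr x y z : f (x ** y) z = f x (z ** bar y).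
Proof.
rewrite -form_barbar cconjM form_mull cconjK -form_barbar cconjM.
by rewrite !cconjK.
Qed.

(** The alternative laws, in the form they take in a composition algebra. *)
Lemma bar_mulK x y : bar x ** (x ** y) = q x *: y.
Proof.
apply: form_inj => w; rewrite form_mull cconjK formE.
have := form_mulM x y x w; rewrite -mulrA.
have -> (a : K) : a + a = 2 * a by ring.
by move/(mulfI two_neq0).
Qed.

Lemma mul_barK x y : (y ** x) ** bar x = q x *: y.
Proof.
rewrite -[LHS](cconjK O) (cconjM O (y ** x)) (cconjM O y) bar_mulK.
by rewrite linearZ_LR /= cconjK form_barbar.
Qed.

Lemma bar_mul2 x y z : bar x ** (z ** y) + bar z ** (x ** y) = (2 * f x z) *: y.
Proof.
have := bar_mulK (x + z) y; rewrite barD !mulE !bar_mulK !formE (formC z) => H.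
have -> : bar x ** (z ** y) + bar z ** (x ** y)  =
  (q x + f x z + (f x z + q z)) *: y - q x *: y - q z *: y.
  by rewrite -H; vring.
by vring.
Qed.

Lemma mul_bar2 x y z : (y ** x) ** bar z + (y ** z) ** bar x = (2 * f x z) *: y.
Proof.
have := mul_barK (x + z) y; rewrite barD !mulE !mul_barK !formE (formC z) => H.
have -> : (y ** x) ** bar z + (y ** z) ** bar x =
  (q x + f x z + (f x z + q z)) *: y - q x *: y - q z *: y.
  by rewrite -H; vring.
by vring.
Qed.

(** A substitute for linear arithmetic: it lets a known equation z = t prove
x = y when the difference of the two is a formal identity. *)
Lemma eq_by_diff (V : zmodType) (x y z t : V) : z = t -> x - y = z - t -> x = y.
Proof. by move=> ->; rewrite subrr => /subr0_eq. Qed.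

(** Left multiplications by imaginary elements satisfy the Clifford relations;
here w need not be imaginary, whence the term in f w e. *)
Lemma imag_mull_swap v w z : imag v ->
  v ** (w ** z) = - (w ** (v ** z)) + (2 * f w e) *: (v ** z) - (2 * f v w) *: z.
Proof.
move=> v0; apply: (eq_by_diff (esym (bar_mul2 v z w))).
rewrite !barE !mulE v0; vring.
Qed.

Lemma imag_comm v w : imag v ->
  v ** w = - (w ** v) + (2 * f w e) *: v - (2 * f v w) *: e.
Proof. by move=> v0; have := imag_mull_swap w e v0; rewrite !cmul1r. Qed.

Lemma imag_form_mull u x y : imag u -> f (u ** x) y = - f x (u ** y).
Proof. move=> u0; rewrite form_mull barE u0 !mulE !formE; ring. Qed.

Lemma imag_form_mulr u x y : imag u -> f (x ** u) y = - f x (y ** u).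
Proof. move=> u0; rewrite form_mulr barE u0 !mulE !formE; ring. Qed.

Lemma imag_split x : exists u a, imag u /\ x = u + a *: e.
Proof.
exists (x - f x e *: e), (f x e); rewrite subrK; split=> //.
by rewrite !formE form_ee; ring.
Qed.

Definition associator x y z := (x ** y) ** z - x ** (y ** z).

(** The linearised law [bar_mul2], minus the case where the vector acted on is 1,
multiplied by z on the right. *)
Lemma associator_swapl x y z : associator x y z = - associator y x z.
Proof.
have h := f_equal2 (fun s t => s - t) (bar_mul2 x z y)
  (congr1 (fun t => t ** z) (bar_mul2 x e y)).
apply: (eq_by_diff h); rewrite /associator !barE !mulE; vring.
Qed.

Lemma associator_swapr x y z : associator x y z = - associator x z y.
Proof.
have h := f_equal2 (fun s t => t - s) (mul_bar2 y x z)
  (congr1 (fun t => x ** t) (mul_bar2 y e z)).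
apply: (eq_by_diff h); rewrite /associator !barE !mulE; vring.
Qed.

Lemma associator_cyc x y z : associator x y z = associator y z x.
Proof. by rewrite associator_swapl associator_swapr opprK. Qed.

(** * Operators that are derivations *)

Definition skew (D : A -> A) := forall x y, f (D x) y = - f x (D y).

(** Derivations are handled as plain functions, so that they can be given by
formulas. *)
Definition der_fun (g : A -> A) := exists2 D : 'End(A), is_derivation M8 D & D =1 g.

Lemma bracketE x y z :
  M8 x y z = (x ** bar y) ** z - f y z *: x + f x z *: y - f x y *: z.
Proof. by []. Qed.

(** For a skew operator the three terms of the bracket with coefficients in the
form are respected, and only (x ybar) z matters. *)
Lemma skew_bar_derivation (D : 'End(A)) : skew D ->
  (forall x y z, D ((x ** bar y) ** z) =
     (D x ** bar y) ** z + (x ** bar (D y)) ** z + (x ** bar y) ** D z) ->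
  is_derivation M8 D.
Proof.
move=> sD hD x y z; rewrite !bracketE !(linearD, linearN, linearZ) /= hD.
rewrite !sD; vring.
Qed.

(** If [D, L_w] is a left multiplication L_c, evaluation at 1 gives
c = D w - w (D 1). The derivation rule for (x ybar) z then reduces to
x (d b) + x (b d) = (x d) b + (x b) d with d = D 1 and b = bar y, which is the
linearised right alternative law. *)
Lemma skew_crit (D : 'End(A)) : skew D ->
  (forall w, exists c, forall z, D (w ** z) = c ** z + w ** D z) ->
  is_derivation M8 D.
Proof.
move=> sD hD.
pose d := D e.
have d0 : imag d.
  have := sD e e; rewrite (formC e) => H; apply: (mulfI two_neq0).
  by rewrite /d mulr0 mulr_natl mulr2n {1}H addNr.
have {}hD w z : D (w ** z) = (D w - w ** d) ** z + w ** D z.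
  have [c hc] := hD w; rewrite hc.
  by have := hc e; rewrite !cmul1r => ->; rewrite addrK.
apply: skew_bar_derivation => // x y z.
have hbar : D (bar y) - d ** bar y - bar y ** d = bar (D y).
  rewrite (imag_comm _ d0) !barE linearD linearN linearZ /= -/d.
  rewrite !mulE !formE form_ee (sD y) -/d (formC y d) d0; vring.
rewrite hD -hbar hD.
have hasc := associator_swapr x d (bar y).
have h := esym (congr1 (fun t => t ** z) hasc).
apply: (eq_by_diff h); rewrite /associator !mulE; vring.
Qed.

Lemma end_of (g : A -> A) : linear g -> exists D : 'End(A), D =1 g.
Proof.
move=> lg; pose G : {linear A -> A} := HB.pack g (GRing.isLinear.Build K A A *:%R g lg).
by exists (linfun G) => x; rewrite lfunE.
Qed.

Lemma der_fun_crit g : linear g -> skew g ->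
  (forall w, exists c, forall z, g (w ** z) = c ** z + w ** g z) -> der_fun g.
Proof.
move=> /end_of[D Dg] sg hg; exists D => //; apply: skew_crit => [x y|w].
  by rewrite !Dg.
by have [c hc] := hg w; exists c => z; rewrite !Dg.
Qed.

Lemma der_fun_lin a g h : der_fun g -> der_fun h ->
  der_fun (fun z => a *: g z + h z).
Proof.
move=> [D hD Dg] [E hE Eh]; exists (a *: D + E).
  exact: is_derivation_closed.
by move=> x; rewrite !lfunE /= lfunE /= Dg Eh.
Qed.

Lemma der_fun_ext g h : g =1 h -> der_fun g -> der_fun h.
Proof. by move=> gh [D hD Dg]; exists D => // x; rewrite Dg. Qed.

(** By the Clifford relations [[L_u, L_v], L_w] = 4 f u w L_v - 4 f v w L_u. *)
Lemma der_comm u v : imag u -> imag v ->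
  der_fun (fun z => u ** (v ** z) - v ** (u ** z)).
Proof.
move=> u0 v0; apply: der_fun_crit => [a x y|x y|w].
- rewrite !mulE; vring.
- rewrite !formE !(imag_form_mull _ _ u0) !(imag_form_mull _ _ v0).
  rewrite !(imag_form_mull _ _ u0); ring.
- have H a b z : imag a -> imag b -> a ** (b ** (w ** z)) =
      w ** (a ** (b ** z)) + (2 * f a w) *: (b ** z) - (2 * f b w) *: (a ** z).
    move=> a0 b0; rewrite (imag_mull_swap w z b0) !mulE.
    rewrite (imag_mull_swap w (b ** z) a0); vring.
  exists ((4 * f u w) *: v - (4 * f v w) *: u) => z.
  rewrite !H // !mulE; vring.
Qed.

(** Here [L_u + 2 R_u, L_w] is the left multiplication by the commutator of u
and w; all the terms are associators of u, w, z. *)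
Lemma der_LR u : imag u -> der_fun (fun z => u ** z + 2 *: (z ** u)).
Proof.
move=> u0; apply: der_fun_crit => [a x y|x y|w].
- rewrite !mulE; vring.
- rewrite !formE imag_form_mull // imag_form_mulr //; ring.
- exists (u ** w - w ** u) => z.
  have h1 := associator_swapl w u z.
  have h2 := associator_cyc u w z.
  apply: (eq_by_diff (f_equal2 (fun s t => s - 2 *: t) h1 h2)).
  rewrite /associator !mulE; vring.
Qed.

(** Four times the generator of the rotation in the plane of a and b, corrected
by the left multiplication by the imaginary part of a (bar b): the factor 4 is
what brings the sum into the spin representation of so(7). *)
Definition spin_der a b z :=
  (a ** bar b) ** z - f a b *: z + 4 *: (f a z *: b - f b z *: a).

(** The associators of u, v, z in their various orders rewrite z (u v - v u) as a
sum of products having a factor u z + z u or v z + z v, and [imag_comm]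
evaluates these factors. *)
Lemma wedge_imag u v z : imag u -> imag v ->
  4 *: (f u z *: v - f v z *: u) =
  u ** (v ** z) - v ** (u ** z) - z ** (u ** v - v ** u).
Proof.
move=> u0 v0.
have H : associator z u v - associator z v u = associator v z u - associator u z v.
  rewrite (associator_swapr u z v) opprK !(associator_cyc z).
  rewrite (associator_cyc v z u) (associator_cyc z u v).
  by rewrite (associator_swapl v u) opprK.
move: H; rewrite /associator (imag_comm z u0) (imag_comm z v0) => H.
apply: (eq_by_diff (esym H)).
rewrite !mulE; vring.
Qed.

(** By bilinearity there are two cases. For imaginary a = u and b = v,
[wedge_imag] gives [L_u, L_v] - (L_c + 2 R_c) / 2 with c the commutator of u
and v; for a = u and b = 1 the operator is - (L_u + 2 R_u). *)
Lemma der_spin_der a b : der_fun (spin_der a b).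
Proof.
have hi u v : imag u -> imag v -> der_fun (spin_der u v).
  move=> u0 v0; have c0 : imag (u ** v - v ** u).
    rewrite !formE !imag_form_mull // !cmul1r (formC v); ring.
  have := der_fun_lin (- 2^-1) (der_LR c0) (der_comm u0 v0).
  apply: der_fun_ext => z; rewrite /spin_der wedge_imag // barE v0 !mulE.
  rewrite (imag_comm u v0) !mulE u0 (formC v).
  by apply: form_inj => w; rewrite !formE; field.
have h1 u : imag u -> der_fun (spin_der u e).
  move=> u0.
  have := der_fun_lin (-2) (der_LR u0) (der_LR u0).
  apply: der_fun_ext => z; rewrite /spin_der bar1 !mulE u0 (formC e).
  have h := congr1 (fun t => - (2 *: t)) (imag_comm z u0).
  apply: (eq_by_diff h); vring.
have [u [s [u0 ->]]] := imag_split a; have [v [t [v0 ->]]] := imag_split b.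
have := der_fun_lin t (h1 _ u0) (hi _ _ u0 v0).
move/(der_fun_lin (- s) (h1 _ v0)); apply: der_fun_ext => z.
rewrite /spin_der barD (linearZ_LR bar) /= bar1 !mulE !formE form_ee u0 v0.
rewrite (formC e v) v0 (barE v) v0 !mulE; vring.
Qed.

(** * Derivations are skew *)

Lemma not_spanned (s : seq A) : (size s < 8)%N -> ~ (forall a, a \in <<s>>%VS).
Proof.
move=> ss H; have : (\dim {:A} <= size s)%N.
  by apply: leq_trans (dim_span s); apply: dimvS; apply/subvP => a _; apply: H.
by rewrite dimA leqNgt ss.
Qed.

(** If the Gram determinant of u and x vanished for all imaginary x, then u would
be orthogonal to everything when q u = 0, and A would be spanned by 1 and u
otherwise. *)
Lemma gram_witness u : imag u -> u != 0 ->
  exists2 x, imag x & q u * q x - f u x ^+ 2 != 0.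
Proof.
move=> u0 un0; apply: boolp.contrapT => H.
have H1 x : imag x -> q u * q x = f u x ^+ 2.
  move=> x0; apply/eqP; rewrite -subr_eq0; apply/negPn/negP => n0.
  by apply: H; exists x.
have H2 x y : imag x -> imag y -> q u * f x y = f u x * f u y.
  move=> x0 y0; have xy0 : imag (x + y) by rewrite formE x0 y0 addr0.
  apply: (mulfI two_neq0); have := H1 _ xy0; rewrite !formE (formC y x) => h.
  have h3 := f_equal2 +%R (H1 _ x0) (H1 _ y0).
  by apply: (eq_by_diff (f_equal2 (fun s t => s - t) h h3)); ring.
have [qu|qu] := eqVneq (q u) 0.
  case/eqP: un0; apply: form_inj => w; have [v [b [v0 ->]]] := imag_split w.
  rewrite form0l !formE u0 mulr0 addr0; apply/eqP.
  by have := H1 _ v0; rewrite qu mul0r => /esym/eqP; rewrite sqrf_eq0.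
apply: (@not_spanned [:: e; u]) => // a.
have [v [b [v0 ->]]] := imag_split a.
have -> : v = (f u v / q u) *: u.
  apply: form_inj => w; have [x [c [x0 ->]]] := imag_split w.
  rewrite !formE v0 u0 !mulr0 !addr0; apply: (mulfI qu).
  by rewrite H2 //; field.
by rewrite memvD // memvZ // memv_span // !inE eqxx ?orbT.
Qed.

Lemma imag_neq0 : exists2 u, imag u & u != 0.
Proof.
apply: boolp.contrapT => H; apply: (@not_spanned [:: e]) => // a.
have [v [b [v0 ->]]] := imag_split a.
suff -> : v = 0 by rewrite add0r memvZ // memv_span // inE.
by apply/eqP/negPn/negP => n0; apply: H; exists v.
Qed.

(** This lemma and the next one are stated for an arbitrary ternary algebra so
that rewriting does not unfold the bracket of M8. *)
Lemma bracket_polar (M : ternaryAlgebra A) x h y z :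
  M (x + h) y (M (x + h) y z) =
  M x y (M x y z) + M x y (M h y z) + M h y (M x y z) + M h y (M h y z).
Proof.
have Dl a b c d : M (a + b) c d = M a c d + M b c d.
  by have := tbr_linear1 M c d 1 a b; rewrite !scale1r.
have Dr a b c d : M a b (c + d) = M a b c + M a b d.
  by have := tbr_linear3 M a b 1 c d; rewrite !scale1r.
by rewrite !Dl !Dr addrA.
Qed.

Lemma derivation_bracket2 (M : ternaryAlgebra A) (D : 'End(A)) x y z :
  is_derivation M D ->
  D (M x y (M x y z)) = M (D x) y (M x y z) + M x (D y) (M x y z)
    + M x y (M (D x) y z) + M x y (M x (D y) z) + M x y (M x y (D z)).
Proof.
move=> hD.
have Dr a b c d : M a b (c + d) = M a b c + M a b d.
  by have := tbr_linear3 M a b 1 c d; rewrite !scale1r.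
by rewrite !hD !Dr !addrA.
Qed.

Lemma bracketNr x y z : M8 x y (- z) = - M8 x y z.
Proof. by rewrite -scaleN1r !bracketE; rewrite mulZr !formE; vring. Qed.

Lemma bracket_swap x y z : M8 y x z = - M8 x y z.
Proof.
have h := congr1 (fun t => 2 *: t ** z) (cformE O x y).
rewrite !mulE !scalerA divff ?two_neq0 // scale1r in h.
rewrite !bracketE; apply: (eq_by_diff (esym h)); rewrite (formC y x); vring.
Qed.

Lemma mul_bar_mul x y : (x ** bar y) ** x = (2 * f x y) *: x - q x *: y.
Proof.
have := mul_bar2 (bar y) x (bar x); rewrite !cconjK form_barbar (formC y) => H.
apply: (eq_by_diff H); have := mul_barK x e; rewrite cmul1l => ->.
rewrite !mulE; vring.
Qed.

Lemma mul_bar_mulr x y : (x ** bar y) ** y = q y *: x.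
Proof. by rewrite -{2}(cconjK O y) mul_barK form_barbar. Qed.

Lemma mul_bar_square x y z :
  (x ** bar y) ** ((x ** bar y) ** z) =
  (2 * f x y) *: ((x ** bar y) ** z) - (q x * q y) *: z.
Proof.
apply: (eq_by_diff (esym (bar_mulK (x ** bar y) z))).
rewrite (barE (x ** _)) (form_mulr _ _ e) cmul1l cconjK.
rewrite cform_multiplicative form_barbar !mulE.
vring.
Qed.

Lemma form_mul_barl x y z : f x ((x ** bar y) ** z) = q x * f y z.
Proof.
rewrite formC form_mull cconjM cconjK -{2}(cconjK O x) mul_barK form_barbar.
by rewrite formE (formC z).
Qed.

Lemma form_mul_barr x y z :
  f y ((x ** bar y) ** z) = 2 * f x y * f y z - q y * f x z.
Proof.
rewrite formC form_mull cconjM cconjK mul_bar_mul !formE !(formC z) (formC y x).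
ring.
Qed.

(** This recovers the Gram determinant of x and y from the bracket alone: up to
sign it is the scalar by which the square of z |-> [x, y, z] acts modulo the
span of x and y. *)
Lemma bracket_square x y z : M8 x y (M8 x y z) =
  (q y * f x z - f x y * f y z) *: x + (q x * f y z - f x y * f x z) *: y
  - (q x * q y - f x y ^+ 2) *: z.
Proof.
rewrite !bracketE !mulE !formE mul_bar_square form_mul_barl form_mul_barr.
rewrite !mul_bar_mul mul_bar_mulr (formC y x); vring.
Qed.

Lemma bracket_swap2 x y x' y' z : M8 y x (M8 y' x' z) = M8 x y (M8 x' y' z).
Proof.
by rewrite (bracket_swap x y) (bracket_swap x' y' z) bracketNr opprK.
Qed.

Lemma bracket_square2 x h y z : M8 x y (M8 h y z) + M8 h y (M8 x y z) =
  (q y * f h z - f h y * f y z) *: x + (q y * f x z - f x y * f y z) *: h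
  + (2 * f x h * f y z - f x y * f h z - f h y * f x z) *: y
  - (2 * (f x h * q y - f x y * f h y)) *: z.
Proof.
have := bracket_square (x + h) y z; rewrite bracket_polar.
have := f_equal2 +%R (bracket_square x y z) (bracket_square h y z).
(* The values of the bracket are abstracted so that they stay folded. *)
move: (M8 x y (M8 x y z)) (M8 x y (M8 h y z)) (M8 h y (M8 x y z)).
move: (M8 h y (M8 h y z)) => t1 t2 t3 t4 H2 H.
apply: (eq_by_diff (f_equal2 (fun s t => s - t) H H2)).
rewrite !formE (formC h x); vring.
Qed.

(** The equation says that D kills the Gram determinant. Applying D to
[bracket_square] and subtracting the polarised identities leaves the derivative
of this determinant times z in the span of x and y, for every z. *)
Lemma derivation_gram (D : 'End(A)) x y : is_derivation M8 D ->
  q y * f x (D x) + q x * f y (D y) = f x y * (f (D x) y + f x (D y)).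
Proof.
move=> hD; apply/eqP; rewrite -subr_eq0; set g := _ - _.
apply/negPn/negP => g0; apply: (@not_spanned [:: x; y]) => // z.
have HD a b c :
    D (a *: x + b *: y - c *: z) = a *: D x + b *: D y - c *: D z.
  by rewrite linearB linearD !linearZ_LR.
have H := congr1 D (bracket_square x y z).
have H1 := bracket_square2 x (D x) y z.
have H2 := bracket_square2 y (D y) x z.
have H3 := bracket_square x y (D z).
rewrite (derivation_bracket2 _ _ _ hD) in H.
rewrite (bracket_swap2 x y x (D y)) (bracket_swap2 x (D y) x y) in H2.
rewrite HD in H.
have [a [b E]] : exists a b, (2 * g) *: z = a *: x + b *: y.
  exists (q y * f (D x) z - f (D x) y * f y z + 2 * f y (D y) * f x z
    - f y x * f (D y) z - f (D y) x * f y z + q y * f x (D z)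
    - f x y * f y (D z)).
  exists (q x * f (D y) z - f (D y) x * f x z + 2 * f x (D x) * f y z
    - f x y * f (D x) z - f (D x) y * f x z + q x * f y (D z)
    - f x y * f x (D z)).
  move: H H1 H2 H3; rewrite /g.
  move: (M8 (D x) y (M8 x y z)) (M8 x (D y) (M8 x y z)) => t1 t2.
  move: (M8 x y (M8 (D x) y z)) (M8 x y (M8 x (D y) z)) => t3 t4.
  move: (M8 x y (M8 x y (D z))) => t5 H H1 H2 H3.
  have E := f_equal2 (fun s t => s - t) H (f_equal2 +%R (f_equal2 +%R H1 H2) H3).
  apply: (eq_by_diff (esym E)); rewrite (formC y x) (formC x (D y)); vring.
suff -> : z = (a / (2 * g)) *: x + (b / (2 * g)) *: y.
  by rewrite memvD // memvZ // memv_span // !inE eqxx ?orbT.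
apply: (scalerI (a := 2 * g)); first by rewrite mulf_neq0 ?two_neq0.
rewrite E; apply: form_inj => w; rewrite !formE; field.
by rewrite g0.
Qed.

(** With B x y = f (D x) y + f x (D y), [derivation_gram] reads G below. Taking
y = 1 shows that B = - B(1, 1) f on imaginary vectors, and then G on a pair with
nonzero Gram determinant gives B(1, 1) = 0; finally G at the pair x, 1 + y shows
that B(1, u) = 0 for imaginary u, again by a nonzero Gram determinant. *)
Lemma derivation_skew (D : 'End(A)) : is_derivation M8 D -> skew D.
Proof.
move=> hD.
pose B x y := f (D x) y + f x (D y).
have BC x y : B x y = B y x by rewrite /B addrC !(formC (D _)).
have BD x y z : B z (x + y) = B z x + B z y by rewrite /B linearD !formE; ring.
have BDl x y z : B (x + y) z = B x z + B y z by rewrite !(BC _ z) BD.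
have BZ a y z : B z (a *: y) = a * B z y by rewrite /B linearZ_LR !formE; ring.
have BZl a y z : B (a *: y) z = a * B y z by rewrite !(BC _ z) BZ.
have Bd x : B x x = 2 * f x (D x) by rewrite /B (formC (D x)); ring.
have G x y : q y * B x x + q x * B y y = 2 * f x y * B x y.
  rewrite !Bd /B -mulrA -derivation_gram //; ring.
have N x : imag x -> B x x = - (q x * B e e).
  by move=> x0; have := G x e; rewrite x0 form_ee => H; apply: (eq_by_diff H); ring.
have P x y : imag x -> imag y -> B x y = - (f x y * B e e).
  move=> x0 y0; have xy0 : imag (x + y) by rewrite formE x0 y0 addr0.
  have := N _ xy0; rewrite BD !BDl (N x) // (N y) // (BC y x) !formE (formC y x) => H.
  by apply: (mulfI two_neq0); apply: (eq_by_diff H); ring.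
have Bee : B e e = 0.
  have [u u0 un0] := imag_neq0; have [x x0 d0] := gram_witness u0 un0.
  apply: (mulfI d0); rewrite mulr0; have := G u x.
  rewrite (N u) // (N x) // (P u x) // => H.
  by apply: (mulfI two_neq0); apply: (eq_by_diff (esym H)); ring.
have P0 x y : imag x -> imag y -> B x y = 0.
  by move=> x0 y0; rewrite P // Bee mulr0 oppr0.
have Q x y : imag x -> imag y -> q x * B e y = f x y * B x e.
  move=> x0 y0; have := G x (e + y).
  rewrite !BD !BDl Bee (P0 x x) // (P0 y y) // (P0 x y) // (BC y e) !formE x0 => H.
  by apply: (mulfI two_neq0); apply: (eq_by_diff H); ring.
have Be u : imag u -> B u e = 0.
  move=> u0; have [->|un0] := eqVneq u 0; first by rewrite /B linear0 !form0l addr0.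
  have [x x0 d0] := gram_witness u0 un0; apply: (mulfI d0).
  rewrite mulr0 mulrBl; apply/eqP; rewrite subr_eq0; apply/eqP.
  have := Q x u x0 u0; have := Q u x u0 x0.
  rewrite !(BC e) (formC x u) => h1 h2.
  by rewrite -mulrA h2 mulrCA h1 expr2 mulrA.
move=> x y; apply/eqP; rewrite -subr_eq0 opprK -/(B x y); apply/eqP.
have [u [a [u0 ->]]] := imag_split x; have [v [b [v0 ->]]] := imag_split y.
rewrite BD !BDl !BZ !BZl P0 // Bee (BC e) !Be //; ring.
Qed.

(** * Skew operators are the local derivations *)

Lemma der_funZ a g : der_fun g -> der_fun (fun z => a *: g z).
Proof.
move=> hg; apply: der_fun_ext (der_fun_lin (a - 1) hg hg) => z.
by rewrite scalerBl scale1r subrK.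
Qed.

(** Any vector pairing to 1 with x becomes isotropic after subtraction of a
multiple of x, which does not change the pairing as q x = 0. *)
Lemma isotropic_dual x : x != 0 -> q x = 0 -> exists a, q a = 0 /\ f a x = 1.
Proof.
move=> x0 qx; have [b bx] : exists b, f b x != 0.
  apply/boolp.not_existsP => H; case/eqP: x0.
  apply: (cform_nonsingular (c := O)) => b; rewrite formC.
  by apply/eqP/negPn/negP; apply: H.
have [c cx] : exists c, f c x = 1.
  by exists ((f b x)^-1 *: b); rewrite formE mulVf.
exists (c - (q c / 2) *: x); rewrite !formE qx cx (formC x) cx; split; last by ring.
by field.
Qed.

(** If q x is nonzero, [spin_der x y] sends x to 3 q x y. If q x = 0, choose an
isotropic a with f a x = 1 and put t = x (bar a), so that L_t^2 = 2 L_t; for z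
orthogonal to x, spin_der a z sends x to (2 + L_t) z - f a z x, and 2 + L_t has
inverse 1/2 - L_t / 8. The remaining multiple of x is removed by
spin_der a x, which sends x to 3 x. *)
Lemma der_orbit x y : x != 0 -> f x y = 0 -> exists2 g, der_fun g & g x = y.
Proof.
move=> x0 xy; have [qx|qx] := eqVneq (q x) 0; last first.
  exists (fun z => (3 * q x)^-1 *: spin_der x y z).
    exact/der_funZ/der_spin_der.
  rewrite /spin_der mul_bar_mul (formC y) xy.
  by apply: form_inj => w; rewrite !formE; field.
have [a [qa ax]] := isotropic_dual x0 qx.
have xa : f x a = 1 by rewrite formC.
pose t := x ** bar a.
have S z : f x z = 0 -> spin_der a z x = 2 *: z + t ** z - f a z *: x.
  move=> xz; have := mul_bar2 (bar z) a (bar x).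
  have := congr1 (fun s => 2 *: s ** z) (cformE O a x).
  rewrite !mulE !scalerA divff ?two_neq0 // !cconjK form_barbar (formC z) xz => h1 h2.
  rewrite /spin_der ax (formC z) xz /t.
  apply: (eq_by_diff (f_equal2 +%R h1 h2)).
  rewrite ax; vring.
pose y' := 2^-1 *: y - 8^-1 *: (t ** y).
have xy' : f x y' = 0 by rewrite !formE form_mul_barl xy qx; ring.
exists (fun z => (f a y' / 3) *: spin_der a x z + spin_der a y' z).
  exact: der_fun_lin (der_spin_der _ _) (der_spin_der _ _).
rewrite !S // (mul_bar_mul x a) xa qx.
have -> : t ** y' = 2^-1 *: (t ** y) - 4^-1 *: (t ** y).
  rewrite /y' !mulE mul_bar_square xa qx.
  by apply: form_inj => w; rewrite !formE; field.
move: (f a y') => s; rewrite ax /y'.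
by apply: form_inj => w; rewrite !formE; field.
Qed.

Lemma skew_local_derivation (D : 'End(A)) : skew D -> is_local_derivation M8 D.
Proof.
move=> sD x; have [->|x0] := eqVneq x 0.
  by exists 0; [exact: is_derivation0 | rewrite !linear0].
have xD : f x (D x) = 0.
  have := sD x x; rewrite formC => H.
  by apply: (mulfI two_neq0); apply: (eq_by_diff H); ring.
have [g [E hE Eg] gx] := der_orbit x0 xD.
by exists E => //; rewrite Eg gx.
Qed.

Lemma local_derivation_skew (D : 'End(A)) : is_local_derivation M8 D -> skew D.
Proof.
move=> lD.
have Q x : f (D x) x = 0.
  have [E /derivation_skew sE ->] := lD x.
  have := sE x x; rewrite (formC x) => H.
  by apply: (mulfI two_neq0); apply: (eq_by_diff H); ring.
move=> x y; have := Q (x + y); rewrite linearD !formE !Q (formC (D y)) => H.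
by apply: (eq_by_diff H); ring.
Qed.

(** * Skew operators are derivations plus left multiplications *)

(** The form identifies A with its dual: phi below is the composite of this
identification with the isomorphism of the dual with A given by the basis. *)
Lemma dual_basis : exists n (b c : 'I_n -> A), forall z,
  z = \sum_i f (b i) z *: c i /\ z = \sum_i f (c i) z *: b i.
Proof.
pose X := vbasis {:A}; exists (\dim {:A}), (fun i => X`_i).
pose phi z := \sum_(i < \dim {:A}) f X`_i z *: X`_i.
have lphi : linear phi.
  move=> a x y; rewrite /phi scaler_sumr -big_split /=; apply: eq_bigr => i _.
  by rewrite !formE scalerDl scalerA.
have [Phi PhiE] := end_of lphi.
have inj : lker Phi == 0%VS.
  rewrite -subv0; apply/subvP => z; rewrite memv_ker PhiE memv0 => /eqP phi0.
  have /freeP /(_ (fun i => f X`_i z) phi0) fX := basis_free (vbasisP {:A}).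
  apply/eqP/form_inj => w; rewrite form0l formC.
  rewrite (coord_vbasis (memvf w)); elim/big_rec: _ => [|i x _ IH].
    exact: form0l.
  by rewrite formE IH formE fX mulr0 addr0.
exists (fun i => (Phi^-1)%VF X`_i) => z.
have E (y : A) : y = \sum_(i < \dim {:A}) f X`_i y *: (Phi^-1)%VF X`_i.
  have im1 x : x \in limg Phi by rewrite (lker0_limgf inj) memvf.
  apply/(lker0P inj); rewrite linear_sum /= {1}PhiE; apply: eq_bigr => i _.
  by rewrite linearZ /= limg_lfunVK.
split; first exact: E.
apply: form_inj => w; rewrite {1}(E w) [in LHS]formC.
elim/big_rec2: _ => [|i x y _ IH]; first by rewrite !form0l.
by rewrite !formE IH mulrC.
Qed.

Definition der_mul_fun (h : A -> A) :=
  exists u g, [/\ imag u, der_fun g & forall z, h z = g z + u ** z].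

Lemma der_mul_lin a h k : der_mul_fun h -> der_mul_fun k ->
  der_mul_fun (fun z => a *: h z + k z).
Proof.
move=> [u [g [u0 hg hE]]] [v [g' [v0 hg' kE]]].
exists (a *: u + v), (fun z => a *: g z + g' z); split.
- by rewrite !formE u0 v0 mulr0 addr0.
- exact: der_fun_lin.
- by move=> z; rewrite hE kE !mulE; vring.
Qed.

Lemma der_mul_wedge a b : der_mul_fun (fun z => f a z *: b - f b z *: a).
Proof.
exists (4^-1 *: (f a b *: e - a ** bar b)), (fun z => 4^-1 *: spin_der a b z).
split.
- rewrite !formE form_ee form_mulr cmul1l cconjK; ring.
- exact/der_funZ/der_spin_der.
move=> z; rewrite /spin_der !mulE.
by apply: form_inj => w; rewrite !formE; field.
Qed.

(** With dual bases b, c one has 2 S z = sum of f (b i) z S (c i) - f (S (c i)) z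
b i, so S is a combination of rotation generators. *)
Lemma skew_split (S : 'End(A)) : skew S ->
  exists u (D : 'End(A)), [/\ imag u, is_derivation M8 D & forall z, S z = D z + u ** z].
Proof.
move=> sS; suff [u [g [u0 [D hD Dg] Sg]]] : der_mul_fun S.
  by exists u, D; split=> // z; rewrite Sg Dg.
have [n [b [c bc]]] := dual_basis.
have SE z : S z =
    2^-1 *: (\sum_i (f (b i) z *: S (c i) - f (S (c i)) z *: b i)).
  apply: (scalerI two_neq0); rewrite scalerA divff ?two_neq0 // scale1r.
  rewrite big_split /= scaler_nat mulr2n; congr (_ + _).
    rewrite {1}(proj1 (bc z)) linear_sum /=; apply: eq_bigr => i _.
    by rewrite linearZ.
  rewrite {1}(proj2 (bc (S z))); apply: eq_bigr => i _.
  by rewrite sS scaleNr opprK.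
have der_mul0 : der_mul_fun (fun=> 0).
  exists 0, (fun=> 0); split; first exact: form0l.
    exists 0; first exact: is_derivation0.
    by move=> z; rewrite lfunE.
  by move=> z; rewrite linear0l addr0.
have der_mul_sum : der_mul_fun
    (fun z => \sum_i (f (b i) z *: S (c i) - f (S (c i)) z *: b i)).
  elim: (index_enum _) => [|i s IH].
    case: der_mul0 => u [g [u0 hg E]]; exists u, g; split=> // z.
    by rewrite big_nil; apply: E.
  have [u [g [u0 hg E]]] := der_mul_lin 1 (der_mul_wedge (b i) (S (c i))) IH.
  by exists u, g; split=> // z; rewrite big_cons -E scale1r.
have [u [g [u0 hg E]]] := der_mul_lin 2^-1 der_mul_sum der_mul0.
by exists u, g; split=> // z; rewrite SE -E addr0.
Qed.

(** * Left multiplications that are derivations *)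

(** The derivation rule for [x, 1, z] gives 2 (u, x, z) = 0. *)
Lemma derivation_mul_associator (D : 'End(A)) u : imag u -> D =1 cmul O u ->
  is_derivation M8 D -> forall x z, associator u x z = 0.
Proof.
move=> u0 Du hD x z; have H := hD x e z.
rewrite !Du !bracketE bar1 !cmul1r in H.
have h1 : f (u ** x) z = - f x (u ** z) by apply: imag_form_mull.
have h2 : f (u ** x) e = - f x u by rewrite imag_form_mull // cmul1r.
have h3 : f e (u ** z) = - f u z by rewrite formC imag_form_mull // cmul1r formC.
rewrite h1 h2 h3 barE u0 in H.
have h4 := associator_swapl x u z.
have E : 2 *: associator u x z = 0.
  apply: (eq_by_diff (f_equal2 (fun s t => t - s) H h4)).
  rewrite /associator !mulE; vring.
by move/eqP: E; rewrite scaler_eq0 (negbTE two_neq0) => /eqP.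
Qed.

(** The quaternion subalgebra spanned by 1, u, x and w = u x + f u x is
nondegenerate, since q w is the Gram determinant d. The formula for the
projection p solves the 2 by 2 Gram system of u and x. If the orthogonal
complement were totally isotropic, the projection would be the identity, and A
would have dimension at most 4. *)
Lemma perp_witness u x : imag u -> imag x -> q u * q x - f u x ^+ 2 != 0 ->
  exists z, [/\ imag z, f z u = 0, f z x = 0, f z (u ** x) = 0 & q z != 0].
Proof.
move=> u0 x0; have [d dE] : exists d, d = q u * q x - f u x ^+ 2 by eexists.
rewrite -dE => d0.
have [w wE] : exists w, w = u ** x + f u x *: e by eexists.
have we : f w e = 0 by rewrite wE !formE form_ee imag_form_mull // cmul1r (formC x); ring.
have uxu : f (u ** x) (u ** e) = q u * f x e by rewrite form_mull bar_mulK formE.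
have uxx : f (u ** x) (e ** x) = q x * f u e by rewrite form_mulr mul_barK formE.
rewrite cmul1r x0 mulr0 in uxu; rewrite cmul1l u0 mulr0 in uxx.
have wu : f w u = 0 by rewrite wE !formE uxu (formC e) u0; ring.
have wx : f w x = 0 by rewrite wE !formE uxx (formC e) x0; ring.
have ww : q w = d.
  rewrite {1}wE formDl formZl (formC e) we mulr0 addr0 wE formDr formZr.
  rewrite cform_multiplicative.
  by rewrite imag_form_mull // cmul1r (formC x u) dE; ring.
apply: boolp.contrapT => H.
pose P z := [/\ imag z, f z u = 0, f z x = 0 & f z w = 0].
have H1 z : P z -> q z = 0.
  move=> [z0 zu zx zw]; apply/eqP/negPn/negP => qz; apply: H; exists z; split=> //.
  by move: zw; rewrite wE formDr formZr z0 mulr0 addr0.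
have H2 y z : P y -> P z -> f y z = 0.
  move=> Py Pz; have Pyz : P (y + z).
    case: Py Pz => y1 y2 y3 y4 [z1 z2 z3 z4].
    by split; rewrite formE ?(y1, y2, y3, y4) ?(z1, z2, z3, z4) addr0.
  apply: (mulfI two_neq0); have := H1 _ Pyz.
  rewrite !formE !H1 // (formC z y) => E; apply: (eq_by_diff E); ring.
have [p pP] : exists p, forall a, P (a - p a) /\ p a \in <<[:: e; u; x; w]>>%VS.
  exists (fun a => f a e *: e + (f a w / d) *: w
    + ((f a u * q x - f a x * f u x) / d) *: u
    + ((f a x * q u - f a u * f u x) / d) *: x) => a; split; last first.
    by rewrite !memvD // memvZ // memv_span // !inE eqxx ?orbT.
  have [eu ex ew] : [/\ f e u = 0, f e x = 0 & f e w = 0] by rewrite !(formC e).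
  have [uw xw] : f u w = 0 /\ f x w = 0 by rewrite !(formC _ w).
  have gram := (form_ee, u0, x0, we, wu, wx, eu, ex, ew, uw, xw, ww, formC x u).
  by subst d; split; rewrite !formE ?gram; field.
apply: (@not_spanned [:: e; u; x; w]) => // a.
suff -> : a = p a by case: (pP a).
apply/eqP; rewrite -subr_eq0; apply/eqP/form_inj => y; rewrite form0l.
have [Pa _] := pP a; have [Py py] := pP y.
rewrite -(subrK (p y) y) formDr H2 // add0r.
move/coord_span: py => ->; case: Pa; move: (a - p a) => v a1 a2 a3 a4.
by rewrite !big_ord_recl big_ord0 addr0 /= !formE a1 a2 a3 a4 !mulr0 !addr0.
Qed.

(** For z orthogonal to the quaternion subalgebra of u and x, the associator of
u, x, z is 2 w z with w = u x + f u x; its norm is 4 (q u q x - f u x ^2) q z. *)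
Lemma derivation_mul_eq0 (D : 'End(A)) u : imag u -> D =1 cmul O u ->
  is_derivation M8 D -> u = 0.
Proof.
move=> u0 Du hD; apply/eqP/negPn/negP => un0.
have [x x0 d0] := gram_witness u0 un0.
have [z [z0 zu zx zux qz]] := perp_witness u0 x0 d0.
have h := derivation_mul_associator u0 Du hD x z.
have [w wE] : exists w, w = u ** x + f u x *: e by eexists.
have w0 : imag w by rewrite wE !formE form_ee imag_form_mull // cmul1r (formC x); ring.
have wz : f w z = 0 by rewrite wE !formE (formC _ z) zux (formC e) z0; ring.
have qw : q w = q u * q x - f u x ^+ 2.
  rewrite {1}wE formDl formZl (formC e) w0 mulr0 addr0 wE formDr formZr.
  rewrite cform_multiplicative.
  by rewrite imag_form_mull // cmul1r (formC x u); ring.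
have wz0 : 2 *: (w ** z) = 0.
  have xz : x ** z = - (z ** x).
    by rewrite (imag_comm z x0) z0 (formC x) zx !mulr0 !scale0r addr0 subr0.
  have uzx : u ** (z ** x) = - (z ** (u ** x)).
    by rewrite (imag_mull_swap z x u0) z0 (formC u) zu !mulr0 !scale0r addr0 subr0.
  have wzC : w ** z = - (z ** w).
    by rewrite (imag_comm z w0) z0 wz !mulr0 !scale0r addr0 subr0.
  rewrite -h /associator xz mulNr uzx opprK scaler_nat mulr2n {2}wzC wE !mulE.
  vring.
move/eqP: wz0; rewrite scaler_eq0 (negbTE two_neq0) /= => /eqP wz0.
have := cform_multiplicative O w z; rewrite wz0 form0l qw => /esym/eqP.
by rewrite mulf_eq0 (negbTE d0) (negbTE qz).
Qed.

(** * Dimension count *)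

Lemma imag_vspace : exists I : {vspace A}, (forall u, u \in I <-> imag u) /\ \dim I = 7%N.
Proof.
have [I IP] : exists I : {vspace A}, forall u, u \in I <-> imag u.
  apply: vspace_of_closed => [|a u v u0 v0]; first exact: form0l.
  by rewrite !formE u0 v0 mulr0 addr0.
exists I; split=> //.
have cap : (<[e]> :&: I = 0)%VS.
  apply/eqP; rewrite -subv0; apply/subvP => x; rewrite memv_cap memv0.
  case/andP=> /vlineP[a ->] /IP; rewrite formE form_ee mulr1 => ->.
  by rewrite scale0r.
have : (<[e]> + I)%VS = fullv.
  apply/eqP; rewrite eqEsubv subvf; apply/subvP => x _.
  have [u [a [u0 ->]]] := imag_split x.
  by rewrite addrC memv_add ?memvZ ?memv_line //; apply/IP.
move/(congr1 (fun U => \dim U)); rewrite dimv_disjoint_sum // dim_vline cone_neq0 dimA.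
by case.
Qed.

Lemma mul_hom : exists L : 'Hom(A, 'End(A)), forall u z, L u z = u ** z.
Proof.
have lmulE u z : linfun (cmul O u) z = u ** z by rewrite lfunE.
have lin : linear (fun u => linfun (cmul O u)).
  by move=> a u v; apply/lfunP => z; rewrite !lfunE /= !lfunE /= !lmulE !mulE.
pose G : {linear A -> 'End(A)} := HB.pack (fun u => linfun (cmul O u))
  (GRing.isLinear.Build K A 'End(A) *:%R _ lin).
by exists (linfun G) => u z; rewrite lfunE /= lmulE.
Qed.

Lemma dim_local_derivations : (\dim (LocDer M8) = \dim (Der M8) + 7)%N.
Proof.
have [I [IP dimI]] := imag_vspace; have [L LE] := mul_hom.
have L_inj : lker L == 0%VS.
  apply/lker0P => u v uv; have := congr1 (fun D : 'End(A) => D e) uv.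
  by rewrite /= !LE !cmul1r.
have -> : LocDer M8 = (Der M8 + L @: I)%VS.
  apply/eqP; rewrite eqEsubv; apply/andP; split; last first.
    rewrite subv_add Der_sub_LocDer; apply/subvP => _ /memv_imgP[u /IP u0 ->].
    apply/LocDerP/skew_local_derivation => x y.
    by rewrite !LE imag_form_mull.
  apply/subvP => S /LocDerP/local_derivation_skew/skew_split[u [D [u0 hD SE]]].
  have -> : S = D + L u by apply/lfunP => z; rewrite lfunE /= LE SE.
  by apply: memv_add; [apply/DerP | apply/memv_img/IP].
rewrite dimv_disjoint_sum.
  by rewrite (limg_dim_eq (U := I)) ?(eqP L_inj) ?capv0 ?dimI.
apply/eqP; rewrite -subv0; apply/subvP => D; rewrite memv_cap memv0.
case/andP=> /DerP hD /memv_imgP[u /IP u0 Du]; apply/eqP; rewrite Du in hD *.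
by rewrite (derivation_mul_eq0 u0 (LE u) hD) linear0.
Qed.

End Octonions.

Theorem mainTheorem5 (R : realType) (A : vectType R[i])
    (O : compositionAlgebra A) (dimA : \dim {:A} = 8%N) :
  let M8 := ternaryMalcev O in
  (exists nabla : 'End(A), is_local_derivation M8 nabla /\ ~ is_derivation M8 nabla)
  /\ \dim {:subvquot (LocDer M8) (Der M8)} = 7%N.
Proof.
move=> M8; have dimL := dim_local_derivations O dimA; split; last first.
  by rewrite dim_subvquot ?Der_sub_LocDer // dimL addKn.
apply: boolp.contrapT => H.
have : (LocDer M8 <= Der M8)%VS.
  apply/subvP => D /LocDerP lD; apply/DerP; apply: boolp.contrapT => nD.
  by apply: H; exists D.
by move/dimvS; rewrite dimL -{2}[\dim (Der M8)]addn0 leq_add2l.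
Qed.
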